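(* Let $\mathcal{H}$ be a complex separable Hilbert space and let $T\in\mathcal{B}(\mathcal{H})$ be such that $\|T\|\leq 1$ and $T^n=0$, where $n\geq 1$ is an integer. Let $r=\dim\mathcal{D}_T$, and let $k\geq 1$ be an integer. Then $\Lambda_k(T)$ is contained in the circular disc $$\left\{z\in\mathbb{C} : |z|\leq\cos\left(\frac{\rho(k,r)\pi}{n+1}\right)\right\}$$ if $1\leq\rho(k,r)\leq\left[\frac{n+1}{2}\right]$, and $\Lambda_k(T)$ is empty if $\rho(k,r)>\left[\frac{n+1}{2}\right]$.
   Context: $\mathcal{B}(\mathcal{H})$ is the collection of all bounded linear operators on $\mathcal{H}$. For $T\in\mathcal{B}(\mathcal{H})$ and an integer $k\geq 1$, the higher rank-$k$ numerical range of $T$ is $$\Lambda_k(T)=\{\lambda\in\mathbb{C} : PTP=\lambda P \text{ for some rank-}k\text{ orthogonal projection } P\}.$$ $D_T=(I-T^*T)^{1/2}$ is the defect operator of $T$, where $I$ is the identity operator on $\mathcal{H}$, and $\mathcal{D}_T$ is the closure of the range of $D_T$. $[x]$ denotes the integer part of $x$. For numbers $k$ and $r$, $\rho(k,r)=k/r$ if $k/r$ is an integer, and $\rho(k,r)=[k/r]+1$ otherwise. *)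

(* Defs.v *)
From HB Require Import structures.
From mathcomp Require Import all_boot all_order all_algebra complex.
From mathcomp Require Import all_classical all_reals all_analysis.

Set Implicit Arguments.
Unset Strict Implicit.
Unset Printing Implicit Defensive.

Import Order.TTheory GRing.Theory Num.Theory.
Import numFieldNormedType.Exports.

Local Open Scope classical_set_scope.
Local Open Scope ring_scope.
Local Open Scope complex_scope.

(* The inner product is linear in its first argument and conjugate-linear in
   its second one. *)
Notation inner_product R H := {dot H for @Num.conj R[i]}.

Definition inner_product_norm (R : realType) (H : completeNormedModType R[i])
  (dot : inner_product R H) := forall x : H, `|x| ^+ 2 = dot x x.

Definition separable_space (X : topologicalType) :=
  exists2 A : set X, countable A & dense A.

(* `|x| lives in R[i]; its real part is the norm of x as an element of R. *)
Definition operator_norm (R : realType) (H : completeNormedModType R[i])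
    (T : H -> H) : \bar R :=
  ereal_sup [set (complex.Re `|T x|)%:E | x in [set x : H | `|x| <= 1]].

Definition bounded_operator (R : realType) (H : completeNormedModType R[i])
  (T : {linear H -> H}) := (operator_norm T < +oo)%E.

Definition adjoint_of (R : realType) (H : completeNormedModType R[i])
    (dot : inner_product R H) (T S : {linear H -> H}) :=
  bounded_operator S /\ forall x y, dot (T x) y = dot x (S y).

(* The order on R[i] is partial: 0 <= z says that z is real and nonnegative. *)
Definition positive_operator (R : realType) (H : completeNormedModType R[i])
    (dot : inner_product R H) (A : {linear H -> H}) :=
  bounded_operator A /\ forall x, 0 <= dot (A x) x.

(* D is the positive square root of I - T^* T, hence determined by T. *)
Definition defect_operator (R : realType) (H : completeNormedModType R[i])
    (dot : inner_product R H) (T D : {linear H -> H}) :=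
  positive_operator dot D /\
  exists2 S : {linear H -> H}, adjoint_of dot T S &
    forall x, D (D x) = x - S (T x).

Definition defect_space (R : realType) (H : completeNormedModType R[i])
  (D : {linear H -> H}) : set H := closure (range D).

Definition span (R : realType) (H : completeNormedModType R[i])
    (B : set H) : set H :=
  [set x | exists (s : seq H) (c : H -> R[i]),
    [set` s] `<=` B /\ x = \sum_(e <- s) c e *: e].

Definition orthonormal_set (R : realType) (H : completeNormedModType R[i])
    (dot : inner_product R H) (B : set H) :=
  forall x y, B x -> B y -> dot x y = (x == y)%:R.

Definition orthonormal_basis (R : realType) (H : completeNormedModType R[i])
    (dot : inner_product R H) (V B : set H) :=
  orthonormal_set dot B /\ closure (span B) = V.

(* Hilbert dimension of a closed subspace V of a separable space: Some m is
   the finite dimension m, None is the (countably) infinite one. *)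
Definition has_dim (R : realType) (H : completeNormedModType R[i])
    (dot : inner_product R H) (V : set H) (d : option nat) :=
  exists2 B : set H, orthonormal_basis dot V B &
    if d is Some m then (B #= `I_m)%card else infinite_set B.

Definition orthogonal_projection (R : realType)
    (H : completeNormedModType R[i]) (dot : inner_product R H)
    (P : {linear H -> H}) :=
  adjoint_of dot P P /\ forall x, P (P x) = P x.

Definition higher_rank_numerical_range (R : realType)
    (H : completeNormedModType R[i]) (dot : inner_product R H)
    (k : nat) (T : {linear H -> H}) : set R[i] :=
  [set z | exists P : {linear H -> H},
    [/\ orthogonal_projection dot P,
        has_dim dot (range P) (Some k) &
        forall x, P (T (P x)) = z *: P x]].

(* The quotient k / r rounded up, for k >= 1. The value None is +oo; it is
   attained for r = 0 only. For r infinite, k / r is rounded up to 1: it is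
   the value of rho k r for every finite r >= k. *)
Definition rho (k : nat) (r : option nat) : option nat :=
  match r with
  | Some 0 => None
  | Some m => Some (if (m %| k)%N then (k %/ m)%N else (k %/ m).+1)
  | None => Some 1%N
  end.

(* Main.v *)
(** The identity <Dx, Dy> = <x, y> - <Tx, Ty> telescopes along the orbit because
    T^n = 0: the map x |-> (D T^j x)_{j < n} is isometric and turns T into a
    shift. For z in the higher rank numerical range and a phase w with wz = |z|,
    the form 2 Re (w <Tx, x>) then becomes that of the adjacency matrix of the
    path on n vertices, evaluated at the vectors w^j D T^j x. The sine transform
    diagonalizes this matrix, with simple eigenvalues 2 cos (m pi / (n + 1)).
    The compression of T to the range of the rank-k projection is the scalar z.
    With p = rho(k, r), killing the first p - 1 spectral components of x, which
    lie in the range of D, amounts to (p - 1) r < k linear equations, so that a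
    nonzero x in the range of the projection satisfies them all; it gives
    |z| <= cos (p pi / (n + 1)), and p <= n because x has a nonzero component. *)

Require Import Defs.
From HB Require Import structures.
From mathcomp Require Import all_boot all_order all_algebra complex.
From mathcomp Require Import all_classical all_reals all_analysis.
From mathcomp Require Import ring lra.

Set Implicit Arguments.
Unset Strict Implicit.
Unset Printing Implicit Defensive.

Import Order.TTheory GRing.Theory Num.Theory.
Import numFieldNormedType.Exports.

Local Open Scope classical_set_scope.
Local Open Scope ring_scope.
Local Open Scope complex_scope.

(** [F n = 0] accounts for [j = n - 1], where no index matches. *)
Lemma sum_succ_ord (V : pzSemiRingType) n (F : nat -> V) (j : 'I_n) : F n = 0 ->
  \sum_(i < n) F i * (j.+1 == i :> nat)%:R = F j.+1.
Proof.
move=> Fn; have [jn|nj] := ltnP j.+1 n.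
  rewrite (bigD1 (Ordinal jn)) //= eqxx mulr1 big1 ?addr0 // => i.
  by rewrite -val_eqE eq_sym /= => /negPf ->; rewrite mulr0.
have -> : j.+1 = n by apply/eqP; rewrite eqn_leq nj ltn_ord.
rewrite Fn big1 // => i _; rewrite gtn_eqF ?mulr0 //.
Qed.

(** * Spectral decomposition of the path matrix *)

Section SineTransform.
Variables (R : realType) (n : nat).

Let angle (m : nat) : R := m%:R * pi / n.+1%:R.

Lemma angle_itv (m : nat) : (m <= n.+1)%N -> angle m \in `[0, pi].
Proof.
move=> mn; rewrite in_itv /= /angle -mulrA mulrCA.
rewrite mulr_ge0 ?pi_ge0 ?divr_ge0 ?ler0n //=.
by rewrite ler_piMr ?pi_ge0 // ler_pdivrMr ?ltr0n // mul1r ler_nat.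
Qed.

Lemma lt_angle (m l : nat) : (angle m < angle l) = (m < l)%N.
Proof. by rewrite /angle !ltr_pM2r ?invr_gt0 ?ltr0n ?pi_gt0 // ltr_nat. Qed.

Lemma lt_cos_angle (m l : nat) : (m <= n.+1)%N -> (l <= n.+1)%N ->
  (cos (angle m) < cos (angle l)) = (l < m)%N.
Proof. by move=> mn ln; rewrite ltr_cos ?angle_itv // lt_angle. Qed.

(** Here 2 m > n + 1, so the angle exceeds pi / 2. A disc of negative radius is empty, whence the
    second claim of the theorem. *)
Lemma cos_angle_lt0 (m : nat) : (n.+1 %/ 2 < m <= n)%N -> cos (angle m) < 0.
Proof.
case/andP=> nm mn; rewrite -(@cos_pihalf R) ltr_cos ?angle_itv ?leqW //.
  rewrite /angle -mulrA mulrCA ltr_pM2l ?pi_gt0 // ltr_pdivlMr ?ltr0n //.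
  rewrite mulrC ltr_pdivrMr ?ltr0n // -natrM ltr_nat.
  by rewrite -ltn_divLR.
have := @pi_ge0 R; rewrite in_itv /=; lra.
Qed.

Definition sine_mx : 'M[R]_n := \matrix_(m, j) sin (j.+1%:R * angle m.+1).

Definition path_mx : 'M[R]_n :=
  \matrix_(i, j) ((i.+1 == j :> nat)%:R + (j.+1 == i :> nat)%:R).

(** Shifting [F] by one and letting it vanish at both ends supplies the neighbours missing at the
    endpoints of the path. *)
Lemma sum_path_mx (F : nat -> R) (j : 'I_n) : F 0 = 0 -> F n.+1 = 0 ->
  \sum_(i < n) F i.+1 * path_mx i j = F j + F j.+2.
Proof.
move=> F0 Fn; under eq_bigr do rewrite mxE mulrDr.
rewrite big_split /=; congr (_ + _).
  case: j => -[|j] /= jn.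
    by rewrite F0 big1 // => i _; rewrite mulr0.
  rewrite (bigD1 (Ordinal (ltnW jn))) //= eqxx mulr1 big1 ?addr0 // => i.
  by rewrite -val_eqE eqSS /= => /negPf ->; rewrite mulr0.
exact: (@sum_succ_ord _ _ (F \o S)).
Qed.

Definition path_eigenvalues : 'rV[R]_n := \row_m (2 * cos (angle m.+1)).

(** The identity sin (t - a) + sin (t + a) = 2 cos a sin t makes each row an eigenvector; the
    boundary values are sin 0 and sin ((m + 1) pi). *)
Lemma sine_path_mx :
  sine_mx *m path_mx = diag_mx path_eigenvalues *m sine_mx.
Proof.
apply/matrixP => m j; rewrite mul_diag_mx !mxE.
under eq_bigr do rewrite mxE.
rewrite (sum_path_mx (F := fun i => sin (i%:R * angle m.+1))).
- set a := angle _.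
  have -> : j%:R * a = j.+1%:R * a - a by rewrite -(@natr1 R j); ring.
  have -> : j.+2%:R * a = j.+1%:R * a + a by rewrite -(@natr1 R j.+1); ring.
  by rewrite sinB sinD; ring.
- by rewrite mul0r sin0.
rewrite /angle mulrC divfK ?pnatr_eq0 //.
elim: (m.+1) => [|l IHl]; first by rewrite mul0r sin0.
by rewrite -natr1 mulrDl mul1r sinDpi IHl oppr0.
Qed.

(** The first entry of the row is positive, its angle lying strictly between 0 and pi. *)
Lemma sine_mx_gram_gt0 (m : 'I_n) : 0 < (sine_mx *m sine_mx^T) m m.
Proof.
have n_gt0 : (0 < n)%N by case: n m => // -[].
rewrite mxE (bigD1 (Ordinal n_gt0)) //= ltr_wpDr //.
  by apply: sumr_ge0 => i _; rewrite !mxE -expr2 sqr_ge0.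
rewrite !mxE -expr2 exprn_gt0 // sin_gt0_pi // mul1r.
have -> : 0 = angle 0 by rewrite /angle !mul0r.
have -> : pi = angle n.+1 by rewrite /angle mulrAC divff ?mul1r // pnatr_eq0.
by rewrite !lt_angle !ltnS ltn_ord.
Qed.

(* The path matrix is symmetric with simple spectrum, so that its
   eigenvectors, the rows of the sine matrix, are orthogonal. *)
Lemma sine_mx_orthogonal (m l : 'I_n) : m != l ->
  (sine_mx *m sine_mx^T) m l = 0.
Proof.
move=> ml; set G := sine_mx *m _.
have path_sym : path_mx^T = path_mx.
  by apply/matrixP => i j; rewrite !mxE addrC.
have GD : G *m diag_mx path_eigenvalues = diag_mx path_eigenvalues *m G.
  rewrite mulmxA -sine_path_mx -!mulmxA; congr (_ *m _).
  by rewrite -{1}tr_diag_mx -trmx_mul -sine_path_mx trmx_mul path_sym.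
move/matrixP/(_ m l): GD; rewrite mul_mx_diag mul_diag_mx !mxE => /eqP.
rewrite mulrC -subr_eq0 -mulrBl mulf_eq0 => /orP[|/eqP//].
rewrite -mulrBr mulf_eq0 pnatr_eq0 /= subr_eq0 => /eqP cosE.
have [] := ltngtP l m; last by move/val_inj => lm; rewrite lm eqxx in ml.
- by rewrite -ltnS -lt_cos_angle ?cosE ?ltxx // ltnS ltnW.
- by rewrite -ltnS -lt_cos_angle ?cosE ?ltxx // ltnS ltnW.
Qed.

(** The rows of the sine matrix are divided by their norms, kept as square roots of the Gram
    diagonal instead of a closed form. *)
Lemma path_mx_spectral : exists2 U : 'M[R]_n, U^T *m U = 1%:M &
  path_mx = U^T *m diag_mx path_eigenvalues *m U.
Proof.
pose G := sine_mx *m sine_mx^T.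
pose d : 'rV[R]_n := \row_m (Num.sqrt (G m m))^-1.
pose U := diag_mx d *m sine_mx.
have UUT : U *m U^T = 1%:M.
  rewrite trmx_mul tr_diag_mx mulmxA -(mulmxA (diag_mx d)) -/G.
  apply/matrixP => m l; rewrite mul_mx_diag mxE mul_diag_mx mxE.
  rewrite [d _ m]mxE [d _ l]mxE [1%:M _ _]mxE.
  have [->|ml] := eqVneq m l; last first.
    by rewrite (sine_mx_orthogonal ml : G m l = 0) mulr0 mul0r.
  have Gl := sine_mx_gram_gt0 l; rewrite -/G in Gl.
  rewrite -[X in _ * X / _](sqr_sqrtr (ltW Gl)) expr2.
  by rewrite mulKf ?divff // gt_eqF ?sqrtr_gt0.
have UTU := mulmx1C UUT.
exists U => //; rewrite -mulmxA.
suff -> : diag_mx path_eigenvalues *m U = U *m path_mx.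
  by rewrite mulmxA UTU mul1mx.
rewrite /U -mulmxA sine_path_mx !mulmxA; congr (_ *m _).
exact: diag_mxC.
Qed.

End SineTransform.

(** * Sesquilinear forms and the defect identity *)

Section InnerProduct.
Variables (R : realType) (H : completeNormedModType R[i]).
Variable dot : inner_product R H.
Local Notation conj := (@Num.conj R[i]).

Lemma dotC (x y : H) : dot x y = conj (dot y x).
Proof. by rewrite hermC expr0 mul1r. Qed.

Lemma dotZl a (x y : H) : dot (a *: x) y = a * dot x y.
Proof. exact: linearZl_LR. Qed.

Lemma dotZr a (x y : H) : dot x (a *: y) = conj a * dot x y.
Proof. exact: linearZr_LR. Qed.

Lemma dot_suml (I : Type) (s : seq I) (f : I -> H) (y : H) :
  dot (\sum_(i <- s) f i) y = \sum_(i <- s) dot (f i) y.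
Proof. exact: linear_sumlz. Qed.

Lemma dot_sumr (I : Type) (s : seq I) (f : I -> H) (x : H) :
  dot x (\sum_(i <- s) f i) = \sum_(i <- s) dot x (f i).
Proof. exact: linear_sumr. Qed.

Lemma dot_ge0 (x : H) : 0 <= dot x x.
Proof.
by have [->|/neq0_dnorm_gt0/ltW//] := eqVneq x 0; rewrite linear0l.
Qed.

Lemma dot_eq0 (x : H) : dot x x = 0 -> x = 0.
Proof.
by have [//|/(@neq0_dnorm_gt0 _ _ _ dot) + xx0] := eqVneq x 0; rewrite xx0 ltxx.
Qed.

(** Polarization: [h] vanishes on the diagonal because [dot (A x) x] is real; testing it on [x + y]
    gives antisymmetry, and using ['i *: y] gives symmetry. *)
Lemma positive_symmetric (A : {linear H -> H}) : positive_operator dot A ->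
  forall x y, dot (A x) y = dot x (A y).
Proof.
case=> _ A_ge0; pose h x y := dot (A x) y - dot x (A y).
have h0 x : h x x = 0.
  apply/eqP; rewrite subr_eq0 [X in _ == X]dotC eq_sym.
  by apply/eqP/CrealP/ger0_real.
have hD x y : h x y + h y x = 0.
  have := h0 (x + y); rewrite /h !(raddfD A) !linearDl !linearDr.
  have := h0 x; have := h0 y; rewrite /h => hy hx hxy.
  rewrite -[RHS]hxy -[LHS]addr0 -[X in _ + X = _]addr0 -{1}hx -hy; ring.
have hB x y : h x y - h y x = 0.
  apply: (mulfI (neq0Ci R[i])); rewrite mulr0 -[RHS]oppr0 -(hD x ('i *: y)).
  by rewrite /h [A ('i *: y)]linearZ !dotZl !dotZr conjCi; ring.
move=> x y; apply/eqP; rewrite -subr_eq0 -/(h x y).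
have := congr2 +%R (hD x y) (hB x y).
by rewrite addrACA subrr !addr0 -mulr2n => /eqP; rewrite mulrn_eq0.
Qed.

Lemma dot_defect (T D : {linear H -> H}) : defect_operator dot T D ->
  forall x y, dot (D x) (D y) = dot x y - dot (T x) (T y).
Proof.
case=> /positive_symmetric Dsym [S [_ TS]] DD x y.
rewrite Dsym DD linearBr; congr (_ - _).
by rewrite TS.
Qed.

Lemma dot_sum_defect (T D : {linear H -> H}) n x y :
  (forall x y, dot (D x) (D y) = dot x y - dot (T x) (T y)) ->
  (forall x, iter n T x = 0) ->
  \sum_(j < n) dot (D (iter j T x)) (D (iter j T y)) = dot x y.
Proof.
move=> dotD Tn0.
suff -> m : \sum_(j < m) dot (D (iter j T x)) (D (iter j T y)) =
            dot x y - dot (iter m T x) (iter m T y).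
  by rewrite !Tn0 linear0l subr0.
elim: m => [|m IHm]; first by rewrite big_ord0 subrr.
by rewrite big_ord_recr /= IHm dotD addrA subrK.
Qed.

(** As [U] is real, conjugate-linearity in the second argument leaves its entries unchanged, so one
    substitution diagonalizes the form in both arguments. *)
Lemma quadratic_form_diag n (U : 'M[R]_n) (d : 'rV[R]_n) (f : 'I_n -> H) :
  \sum_i \sum_j ((U^T *m diag_mx d *m U) i j)%:C * dot (f i) (f j) =
  \sum_m (d 0 m)%:C *
    dot (\sum_j (U m j)%:C *: f j) (\sum_j (U m j)%:C *: f j).
Proof.
transitivity (\sum_i \sum_j \sum_m
    (U m i)%:C * (d 0 m)%:C * (U m j)%:C * dot (f i) (f j)).
  apply: eq_bigr => i _; apply: eq_bigr => j _.
  rewrite mxE rmorph_sum mulr_suml; apply: eq_bigr => m _.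
  by rewrite mul_mx_diag !mxE !rmorphM.
under eq_bigr do rewrite exchange_big /=.
rewrite exchange_big; apply: eq_bigr => m _ /=.
rewrite dot_suml mulr_sumr; apply: eq_bigr => i _.
rewrite dot_sumr mulr_sumr; apply: eq_bigr => j _.
by rewrite dotZl dotZr (conjc_real _ : conj _ = _); ring.
Qed.

(** Otherwise the ball around [x] with radius the norm of [x] would meet the span in some [y]
    orthogonal to [x], against Pythagoras for [x - y]. *)
Lemma orthogonal_closure_span (B : set H) x : inner_product_norm dot ->
  closure (Defs.span B) x -> (forall e, B e -> dot x e = 0) -> x = 0.
Proof.
move=> dotE Bx xB; apply/eqP; rewrite -normr_eq0; apply: contraT => nx0.
have nx_gt0 : 0 < `|x| by rewrite lt_def nx0 normr_ge0.
have [y [[s [c [sB yE]]]]] := Bx _ (nbhsx_ballx x _ nx_gt0).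
rewrite -ball_normE /= ; rewrite -(ltr_pXn2r (n := 2)) ?nnegrE //.
have xy : dot x y = 0.
  rewrite yE dot_sumr big1_seq // => e /andP[_ es].
  by rewrite dotZr xB ?mulr0 //; exact: sB.
by rewrite !dotE hnormBd // gtrDl => /(le_lt_trans (dot_ge0 y)); rewrite ltxx.
Qed.

End InnerProduct.


(** * Components of the orbit of [T] in the eigenbasis of the path *)

Section SpectralComponents.
Variables (R : realType) (H : completeNormedModType R[i]).
Variables (dot : inner_product R H) (T D : {linear H -> H}).
Variables (n : nat) (w : R[i]).
Hypothesis dotD : forall x y, dot (D x) (D y) = dot x y - dot (T x) (T y).
Hypothesis Tn0 : forall x, iter n T x = 0.
Hypothesis w1 : w * Num.conj w = 1.

(** [D] stays outside the sum, which makes membership in its range immediate. *)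
Definition spectral_component (U : 'M[R]_n) (m : 'I_n) (x : H) : H :=
  D (\sum_(j < n) ((U m j)%:C * w ^+ j) *: iter j T x).

Lemma spectral_component_is_linear U m : linear (spectral_component U m).
Proof.
have iterL j : linear (iter j T).
  by elim: j => [//|j IHj] a x y; rewrite !iterS IHj linearP.
move=> a x y; rewrite -linearP; congr (D _).
rewrite scaler_sumr -big_split; apply: eq_bigr => j _ /=.
by rewrite iterL scalerDr !scalerA [a * _]mulrC.
Qed.

HB.instance Definition _ U m := GRing.isLinear.Build _ _ _ _
  (spectral_component U m) (spectral_component_is_linear U m).

Lemma spectral_components : exists h : 'I_n -> {linear H -> H},
  [/\ forall m x, range D (h m x),
      forall x, \sum_(m < n) dot (h m x) (h m x) = dot x x &
      forall x, \sum_(m < n) (2 * cos (m.+1%:R * pi / n.+1%:R))%:C *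
                  dot (h m x) (h m x) =
        w * dot (T x) x + Num.conj (w * dot (T x) x)].
Proof.
have [U UU pathU] := path_mx_spectral R n.
exists (fun m => spectral_component U m).
have DZ a y : D (a *: y) = a *: D y by exact: linearZ.
pose f x j := D (w ^+ j *: iter j T x).
have hE m x : spectral_component U m x = \sum_j (U m j)%:C *: f x j.
  rewrite /spectral_component linear_sum; apply: eq_bigr => j _ /=.
  by rewrite -scalerA DZ.
(* The phases combine to [w ^+ l] as [w] is unimodular; [l = 0] serves for the norm, [l = 1] for the
   form. *)
have dotf x j l : dot (f x (l + j)%N) (f x j) =
    w ^+ l * dot (D (iter (l + j) T x)) (D (iter j T x)).
  rewrite /f !DZ dotZl dotZr mulrA; congr (_ * _).
  by rewrite exprD -mulrA rmorphXn -exprMn w1 expr1n mulr1.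
split=> [m x|x|x].
- by rewrite /=; eexists.
- transitivity (\sum_m ((const_mx 1 : 'rV[R]_n) 0 m)%:C *
      dot (\sum_j (U m j)%:C *: f x j) (\sum_j (U m j)%:C *: f x j)).
    by apply: eq_bigr => m _; rewrite mxE mul1r -hE.
  rewrite -quadratic_form_diag diag_const_mx mulmx1 UU.
  rewrite -(dot_sum_defect x x dotD Tn0); apply: eq_bigr => i _.
  rewrite (bigD1 i) //= mxE eqxx mul1r big1 ?addr0 => [|j ji].
    by rewrite (dotf x i 0%N) expr0 mul1r.
  by rewrite mxE eq_sym (negPf ji) mul0r.
transitivity (\sum_m ((path_eigenvalues R n) 0 m)%:C *
    dot (\sum_j (U m j)%:C *: f x j) (\sum_j (U m j)%:C *: f x j)).
  by apply: eq_bigr => m _; rewrite mxE -hE.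
rewrite -quadratic_form_diag -pathU.
have fn : f x n = 0 by rewrite /f Tn0 scaler0 linear0.
(* [T] commutes with its powers, so this is the telescoped identity for the pair [T x], [x]. *)
have sum_shift : \sum_(j < n) dot (f x j.+1) (f x j) = w * dot (T x) x.
  rewrite -(dot_sum_defect (T x) x dotD Tn0) mulr_sumr.
  by apply: eq_bigr => j _; rewrite (dotf x j 1%N) expr1 -iterSr.
transitivity (\sum_(i < n) \sum_(j < n) (dot (f x i) (f x j) * (i.+1 == j :> nat)%:R +
                             dot (f x i) (f x j) * (j.+1 == i :> nat)%:R)).
  apply: eq_bigr => i _; apply: eq_bigr => j _.
  by rewrite mxE rmorphD !rmorph_nat mulrDl ![_%:R * _]mulrC.
under eq_bigr do rewrite big_split.
(* One off-diagonal of the path gives w <Tx, x>, the other its conjugate; [fn] settles the last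
   index. *)
rewrite big_split [LHS]addrC /=; congr (_ + _).
  rewrite exchange_big -sum_shift; apply: eq_bigr => j _.
  apply: (sum_succ_ord (F := fun i => dot (f x i) (f x j))).
  by rewrite fn linear0l.
rewrite -sum_shift rmorph_sum; apply: eq_bigr => i _.
transitivity (dot (f x i) (f x i.+1)); last exact: dotC.
apply: (sum_succ_ord (F := fun j => dot (f x i) (f x j))).
by rewrite fn linear0r.
Qed.

End SpectralComponents.

Lemma unimodular_phase (R : realType) (z : R[i]) :
  exists2 w, w * Num.conj w = 1 & w * z = `|z|.
Proof.
have [->|z0] := eqVneq z 0.
  by exists 1; rewrite ?rmorph1 ?mulr1 // mulr0 normr0.
exists (`|z| / z); last by rewrite divfK.
by rewrite -normCK normrM normfV normr_id divff ?expr1n // normr_eq0.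
Qed.

(** The [k] by [#|J|] coefficient matrix has rank below [k], hence a nonzero left kernel. *)
Lemma nonzero_solution (F : fieldType) (J : finType) k (a : J -> 'I_k -> F) :
  (#|J| < k)%N ->
  exists2 c : 'rV[F]_k, c != 0 & forall j, \sum_i c 0 i * a j i = 0.
Proof.
move=> Jk; pose A : 'M[F]_(k, #|J|) := \matrix_(i, j) a (enum_val j) i.
have kerA : kermx A != 0.
  by rewrite kermx_eq0 /row_free ltn_eqF // (leq_ltn_trans (rank_leq_col A)).
exists (nz_row (kermx A)); first by rewrite nz_row_eq0.
move=> j; have /sub_kermxP/matrixP/(_ 0 (enum_rank j)) := nz_row_sub (kermx A).
rewrite mxE [RHS]mxE => cA; rewrite -[RHS]cA.
by apply: eq_bigr => i _; rewrite [A _ _]mxE enum_rankK.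
Qed.

(** * Bounds on the higher rank numerical range *)

Section HigherRank.
Variables (R : realType) (H : completeNormedModType R[i]).
Variable dot : inner_product R H.

Lemma orthonormal_basis_enum (V B : set H) k : orthonormal_basis dot V B ->
  (B #= `I_k)%card ->
  exists b : 'I_k -> H, [/\ forall i, V (b i), forall e, B e -> exists i, b i = e
    & forall i j, dot (b i) (b j) = (i == j)%:R].
Proof.
move=> [Bon <-]; rewrite card_eq_sym => /card_set_bijP[f [fB finj fsurj]].
exists (fun i => f i); split=> [i|e /fsurj[i ik <-]|i j].
- apply: subset_closure; exists [:: f i], (fun=> 1).
  by split=> [e|]; rewrite ?big_seq1 ?scale1r //= inE => /eqP ->; exact/fB/ltn_ord.
- by exists (Ordinal (ik : (i < k)%N)).
rewrite Bon; [|exact/fB/ltn_ord..]; congr (nat_of_bool _)%:R.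
apply/eqP/eqP => [fij|-> //].
by apply/val_inj/finj => //; rewrite inE; exact: ltn_ord.
Qed.

(** [P] fixes every combination of the [b i], and its self-adjointness turns <Tx, x> into <PTPx,
    x>. *)
Lemma higher_rank_frame k (T : {linear H -> H}) z :
  higher_rank_numerical_range dot k T z ->
  exists2 b : 'I_k -> H, forall i j, dot (b i) (b j) = (i == j)%:R &
    forall (c : 'rV[R[i]]_k) (x := \sum_i c 0 i *: b i),
      dot (T x) x = z * dot x x.
Proof.
case=> P [[[_ Psym] Pid] [B Bbasis Bk] PTP].
have [b [Pb _ b_on]] := orthonormal_basis_enum Bbasis Bk; exists b => // c x.
have Px : P x = x.
  rewrite linear_sum; apply: eq_bigr => i _ /=.
  by have [y _ <-] := Pb i; rewrite linearZ /= Pid.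
by rewrite -{1 2}Px -Psym PTP Px dotZl.
Qed.

(** The surviving indices satisfy [p <= m.+1], so their cosines are at most the bound, cosine being
    decreasing on [0, pi]; the weighted sum equals 2 |z| <x, x>. *)
Lemma constrained_numerical_bound n (T : {linear H -> H})
    (h : 'I_n -> {linear H -> H}) (w z : R[i]) p x :
  (forall x, \sum_(m < n) dot (h m x) (h m x) = dot x x) ->
  (forall x, \sum_(m < n) (2 * cos (m.+1%:R * pi / n.+1%:R))%:C *
               dot (h m x) (h m x) =
     w * dot (T x) x + Num.conj (w * dot (T x) x)) ->
  w * z = `|z| -> x != 0 -> dot (T x) x = z * dot x x ->
  (forall m : 'I_n, (m.+1 < p)%N -> h m x = 0) ->
  (p <= n)%N /\ `|z| <= (cos (p%:R * pi / n.+1%:R))%:C.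
Proof.
move=> hnorm hT wz x0 Tx hx0.
have xx0 : 0 < dot x x by exact: neq0_dnorm_gt0.
have pn : (p <= n)%N.
  rewrite leqNgt; apply/negP => np; move: xx0; rewrite -hnorm big1 ?ltxx // => m _.
  by rewrite hx0 ?linear0l // (leq_ltn_trans _ np).
split=> //; rewrite -(ler_pM2r xx0) -(ler_pM2l (ltr0n _ 2 : 0 < 2%:R)).
have -> : 2%:R * (`|z| * dot x x) = w * dot (T x) x + Num.conj (w * dot (T x) x).
  rewrite Tx [w * _]mulrA wz; have /CrealP -> : `|z| * dot x x \is Num.real.
    by rewrite ger0_real // mulr_ge0 // ltW.
  by rewrite mulr2n mulrDl mul1r.
rewrite -hT -hnorm !mulr_sumr; apply: ler_sum => m _.
have [mp|pm] := ltnP m.+1 p; first by rewrite hx0 // linear0l !mulr0.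
rewrite mulrA; apply: ler_wpM2r; first exact: dot_ge0.
rewrite rmorphM rmorph_nat ler_pM2l ?ltr0n // lecR.
by rewrite leNgt lt_cos_angle -?leqNgt // leqW.
Qed.

(** The guard [1 < p] lets an infinite-dimensional defect space be treated with [p = 1] and an empty
    family [E]. *)
Lemma higher_rank_bound n k p m (T D : {linear H -> H}) (E : 'I_m -> H) z :
  (forall x y, dot (D x) (D y) = dot x y - dot (T x) (T y)) ->
  (forall x, iter n T x = 0) ->
  (p.-1 * m < k)%N ->
  ((1 < p)%N -> forall y, range D y -> (forall i, dot y (E i) = 0) -> y = 0) ->
  higher_rank_numerical_range dot k T z ->
  (p <= n)%N /\ `|z| <= (cos (p%:R * pi / n.+1%:R))%:C.
Proof.
move=> dotD Tn0 pmk Etotal /higher_rank_frame[b b_on bT].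
have [w w1 wz] := unimodular_phase z.
have [h [hD hnorm hT]] := spectral_components dotD Tn0 w1.
(* Coefficient of the [i]-th unknown in equation [s]. As [p <= n] is not known yet, [s.1] may be no
   index of a component; the default 0 then makes the equation trivial. *)
pose a (s : 'I_p.-1 * 'I_m) i :=
  if insub (s.1 : nat) is Some l then dot (h l (b i)) (E s.2) else 0.
have [|c c0 ca] := @nonzero_solution _ _ k a; first by rewrite card_prod !card_ord.
pose x := \sum_i c 0 i *: b i.
apply: (constrained_numerical_bound (x := x) hnorm hT wz) => [||l lp].
- apply: contra_neq c0 => x0; apply/rowP => i; rewrite mxE.
  have : dot x (b i) = 0 by rewrite x0 linear0l.
  rewrite dot_suml (bigD1 i) //=.
  rewrite dotZl b_on eqxx mulr1 big1 ?addr0 // => j ji.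
  by rewrite dotZl b_on (negPf ji) mulr0.
- exact: bT.
have lp' : (l < p.-1)%N by case: (p) lp.
apply: Etotal => [||i]; [exact: leq_ltn_trans lp|exact: hD|].
rewrite -[RHS](ca (Ordinal lp', i)) linear_sum dot_suml.
by apply: eq_bigr => j _; rewrite linearZ /= dotZl /a /= valK.
Qed.

End HigherRank.

Theorem theorem2p4 (R : realType) (H : completeNormedModType R[i])
    (dot : inner_product R H) (dotE : inner_product_norm dot)
    (Hsep : separable_space H)
    (T : {linear H -> H}) (Tbounded : bounded_operator T)
    (Tcontraction : (operator_norm T <= 1)%E)
    (n : nat) (n_ge1 : (1 <= n)%N) (Tnil : forall x, iter n T x = 0)
    (D : {linear H -> H}) (DT : defect_operator dot T D)
    (r : option nat) (rdim : has_dim dot (defect_space D) r)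
    (k : nat) (k_ge1 : (1 <= k)%N) :
  match rho k r with
  | Some p =>
      ((1 <= p <= n.+1 %/ 2)%N ->
        higher_rank_numerical_range dot k T `<=`
        [set z : R[i] | `|z| <= (cos (p%:R * pi / n.+1%:R))%:C]) /\
      ((n.+1 %/ 2 < p)%N -> higher_rank_numerical_range dot k T = set0)
  | None => higher_rank_numerical_range dot k T = set0
  end.
Proof.
have dotD := dot_defect DT.
(* An orthonormal basis of the defect space separates the vectors in the range of [D]. *)
have total m : has_dim dot (defect_space D) (Some m) -> exists E : 'I_m -> H,
    forall y, range D y -> (forall i, dot y (E i) = 0) -> y = 0.
  case=> B Bbasis Bm; have [E [_ BE _]] := orthonormal_basis_enum Bbasis Bm.
  exists E => y /subset_closure Dy yE.
  have By : closure (Defs.span B) y by case: Bbasis => _ ->.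
  by apply: (orthogonal_closure_span dotE By) => e /BE[i <-].
suff bound p : rho k r = Some p -> forall z,
    higher_rank_numerical_range dot k T z ->
    (p <= n)%N /\ `|z| <= (cos (p%:R * pi / n.+1%:R))%:C.
  case rhoE : (rho k r) => [p|]; last first.
    case: r rdim rhoE {bound} => [[|m]|] // /total[E Etotal] _.
    apply/seteqP; split=> // z Tz.
    (* For r = 0 every [p] satisfies (p - 1) r < k; the choice [n.+1] contradicts the conclusion
       [p <= n]. *)
    have [|] := higher_rank_bound (p := n.+1) dotD Tnil _ (fun=> Etotal) Tz.
      by rewrite muln0.
    by rewrite ltnn.
  split=> [_ z /(bound p rhoE)[]//|np].
  apply/seteqP; split=> // z /(bound p rhoE)[pn].
  by move=> /(le_trans (normr_ge0 z)); rewrite ler0c leNgt cos_angle_lt0 // np.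
case: r rdim => [[|m]|] //= rdim [<-] z.
  have [E Etotal] := total _ rdim.
  apply: (higher_rank_bound dotD Tnil _ (fun=> Etotal)).
  (* (p - 1) r is k - r if r divides k, and otherwise the largest multiple of r below k. *)
  case: ifPn => [mk|]; last first.
    by rewrite dvdn_eq /= ltn_neqAle leq_trunc_div andbT.
  by rewrite -subn1 mulnBl mul1n divnK // ltn_subrL k_ge1.
by apply: (@higher_rank_bound _ _ _ _ _ _ 0 _ _ (fun=> 0) _ dotD Tnil).
Qed.
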